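(* The number of gradient evaluations performed by any randomized incremental gradient method for finding a solution $\bar x\in X$ of the problem $\min_{x\in X}\{\Psi(x)=\sum_{i=1}^mf_i(x)+h(x)+\mu\,\omega(x)\}$ (in the worst case over problems of this class) such that $\mathbb{E}[\|\bar x-x^*\|_2^2]\le\epsilon$ cannot be smaller than $$\Omega\Big\{\big(\sqrt{m\,\mathcal{C}}+m\big)\log\frac{\|x^0-x^*\|_2^2}{\epsilon}\Big\}$$ if $n$ is sufficiently large, where $\mathcal{C}=L/\mu$ and $L=\sum_{i=1}^mL_i$.
   Context: Problem class: $X\subseteq\mathbb{R}^n$ closed convex; $f_i:\mathbb{R}^n\to\mathbb{R}$ ($i=1,\dots,m$) convex and differentiable with $L_i$-Lipschitz continuous gradients; $h$ convex; $\omega:X\to\mathbb{R}$ strongly convex with modulus $1$; $\mu>0$; $x^*$ the optimal solution; $\|\cdot\|_2$ the Euclidean norm (here used for Lipschitz constants and strong convexity). Randomized incremental gradient method: a method that at iteration $t$ acquires the gradient of one randomly selected component $f_{i_t}$, where $i_1,i_2,\dots$ are independent with $\mathrm{Prob}\{i_t=i\}=p_i$, $p_i\ge0$, $\sum_{i=1}^mp_i=1$, and that generates test points satisfying $x^k\in x^0+\mathrm{Lin}\{\nabla f_{i_1}(x^0),\dots,\nabla f_{i_k}(x^{k-1})\}$, where $\mathrm{Lin}$ denotes the linear span. $\Omega\{\cdot\}$ hides a universal positive constant; how large $n$ must be may depend on the other problem parameters and on $\epsilon$. *)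

(* Defs.v *)
From HB Require Import structures.
From mathcomp Require Import all_boot all_order all_algebra.
From mathcomp Require Import all_classical all_reals all_analysis.

Set Implicit Arguments.
Unset Strict Implicit.
Unset Printing Implicit Defensive.

Import Order.TTheory GRing.Theory Num.Theory.
Import numFieldNormedType.Exports.

Local Open Scope classical_set_scope.
Local Open Scope ring_scope.

(* Formalized with MathComp-Analysis over an arbitrary [R : realType]. *)

(* The library norm [`|x|] on ['rV[R]_n] is the sup norm, and is used only
   through the (norm-independent) topology. *)
Definition enorm (R : realType) (n : nat) (x : 'rV[R]_n) : R :=
  Num.sqrt (\sum_(j < n) x 0 j ^+ 2).

Definition grad (R : realType) (n : nat) (f : 'rV[R]_n -> R) (x : 'rV[R]_n) :
    'rV[R]_n :=
  \row_j 'd (f : 'rV[R]_n -> R^o) x (delta_mx 0 j).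

Definition strongly_convex1 (R : realType) (n : nat) (X : set 'rV[R]_n)
    (w : 'rV[R]_n -> R) :=
  forall (x y : 'rV[R]_n) (t : R), X x -> X y -> 0 <= t <= 1 ->
    w (t *: x + (1 - t) *: y) <=
      t * w x + (1 - t) * w y - 2^-1 * t * (1 - t) * enorm (x - y) ^+ 2.

(* [simple] and [dgf] stand for h and omega; only their values on [feasible]
   matter.  [lip i] is a Lipschitz constant, not necessarily the least one. *)
Record problem (R : realType) (m n : nat) := Problem {
  feasible : set 'rV[R]_n;
  component : 'I_m -> 'rV[R]_n -> R;
  simple : 'rV[R]_n -> R;
  dgf : 'rV[R]_n -> R;
  modulus : R;
  lip : 'I_m -> R;
  feasible_closed : closed feasible;
  feasible_convex : convex_set feasible;
  component_convex : forall i, convex_function setT (component i);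
  component_differentiable : forall i (x : 'rV[R]_n),
    differentiable (component i : 'rV[R]_n -> R^o) x;
  lip_gt0 : forall i, 0 < lip i;
  component_lipschitz : forall i (x y : 'rV[R]_n),
    enorm (grad (component i) x - grad (component i) y)
      <= lip i * enorm (x - y);
  simple_convex : convex_function feasible simple;
  dgf_strongly_convex : strongly_convex1 feasible dgf;
  modulus_gt0 : 0 < modulus
}.

Definition objective (R : realType) (m n : nat) (P : problem R m n)
    (x : 'rV[R]_n) : R :=
  \sum_(i < m) component P i x + simple P x + modulus P * dgf P x.

Definition optimal (R : realType) (m n : nat) (P : problem R m n)
    (xs : 'rV[R]_n) :=
  feasible P xs /\ forall x, feasible P x -> objective P xs <= objective P x.

Definition total_lip (R : realType) (m n : nat) (P : problem R m n) : R :=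
  \sum_(i < m) lip P i.

Definition cond_number (R : realType) (m n : nat) (P : problem R m n) : R :=
  total_lip P / modulus P.

(* [idx t] is the component drawn at iteration t + 1. *)
Definition iid_sampling (d : measure_display) (T : measurableType d)
    (R : realType) (Pr : probability T R) (m : nat) (p : 'I_m -> R)
    (idx : nat -> T -> 'I_m) :=
  [/\ forall i, 0 <= p i,
      \sum_(i < m) p i = 1,
      forall t i, measurable (idx t @^-1` [set i]),
      forall t i, Pr (idx t @^-1` [set i]) = (p i)%:E &
      forall (J : seq nat) (B : nat -> set 'I_m), uniq J ->
        Pr (\bigcap_(t in [set` J]) idx t @^-1` B t)
          = (\prod_(t <- J) Pr (idx t @^-1` B t))%E].

(* A method is a sampling scheme [p], [idx] together with a rule [iter] giving,
   for each problem and each starting point, the random test points x^k.  The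
   rule may use all the data of the problem and randomness of its own carried
   by [T]; it is constrained only by the span condition, which for k = 0 says
   that x^0 is the starting point.  Computing x^1, ..., x^k costs k gradient
   evaluations. *)
Definition incremental_gradient_method (d : measure_display)
    (T : measurableType d) (R : realType) (Pr : probability T R) (m n : nat)
    (p : 'I_m -> R) (idx : nat -> T -> 'I_m)
    (iter : problem R m n -> 'rV[R]_n -> nat -> T -> 'rV[R]_n) :=
  iid_sampling Pr p idx /\
  forall (P : problem R m n) (x0 : 'rV[R]_n), feasible P x0 ->
  forall k,
    (forall j, measurable_fun setT (fun w => iter P x0 k w 0 j)) /\
    (forall w, iter P x0 k w - x0 \in
       <<[seq grad (component P (idx t w)) (iter P x0 t w)
            | t <- iota 0 k]>>%VS).

Definition finds_solution (d : measure_display) (T : measurableType d)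
    (R : realType) (Pr : probability T R) (m n : nat) (P : problem R m n)
    (xs : 'rV[R]_n) (eps : R) (xbar : T -> 'rV[R]_n) :=
  (forall w, feasible P (xbar w)) /\
  ('E_Pr[fun w => (enorm (xbar w - xs) ^+ 2)%R] <= eps%:E)%E.

(* The span condition only lets a method move along gradients of the f_i, so
   for arbitrary X, h and omega the solution can be made unreachable by hiding
   it in h or omega (e.g. all f_i = 0).  In a plain problem X, h and omega carry
   no information beyond the starting point, and any lower bound must come from
   the difficulty of the f_i. *)
Definition plain_problem (R : realType) (m n : nat) (P : problem R m n)
    (x0 : 'rV[R]_n) :=
  [/\ feasible P = setT,
      simple P = (fun=> 0) &
      dgf P = (fun x => 2^-1 * enorm (x - x0) ^+ 2)].

(* Main.v *)
Require Import Defs.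
From HB Require Import structures.
From mathcomp Require Import all_boot all_order all_algebra.
From mathcomp Require Import ring lra.
From mathcomp Require Import all_classical all_reals all_analysis.
From mathcomp Require Import measurable_realfun.

Import Order.TTheory GRing.Theory Num.Theory.
Import numFieldNormedType.Exports.

Local Open Scope classical_set_scope.
Local Open Scope ring_scope.

(** Some component i0 is drawn with probability at most 1/m, and all the
    difficulty is put into f_{i0}; the other components vanish.  If L/mu < m and
    m > 1, a linear f_{i0} suffices: as long as i0 has not been drawn, an event
    of probability at least (1 - 1/m)^k, the method sits at x^0.  If L/mu >= m,
    f_{i0} is Nesterov's tridiagonal quadratic with curvature L/m, whose
    solution is the geometric sequence B q^j with 1/q = 1 + 6/s and
    s = sqrt(L/(m mu)).  Each draw of i0 uncovers one more coordinate, so after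
    r draws the squared distance to x^* is about D^2 q^(2r); by convexity its
    mean is about D^2 q^(2k/m) or more.  If m = 1 and L < mu, the solution is
    hidden in omega. *)

Set Implicit Arguments.
Unset Strict Implicit.
Unset Printing Implicit Defensive.

(** * Inner product and Euclidean norm of row vectors *)

Definition dot (R : realType) (n : nat) (u v : 'rV[R]_n) : R := (u *m v^T) 0 0.

Lemma dotE (R : realType) (n : nat) (u v : 'rV[R]_n) :
  dot u v = \sum_j u 0 j * v 0 j.
Proof. by rewrite /dot mxE; apply: eq_bigr => j _; rewrite mxE. Qed.

Lemma dotC (R : realType) (n : nat) (u v : 'rV[R]_n) : dot u v = dot v u.
Proof. by rewrite !dotE; apply: eq_bigr => j _; rewrite mulrC. Qed.

Lemma dotDl (R : realType) (n : nat) (u v w : 'rV[R]_n) :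
  dot (u + v) w = dot u w + dot v w.
Proof. by rewrite /dot mulmxDl mxE. Qed.

Lemma dotNl (R : realType) (n : nat) (u w : 'rV[R]_n) : dot (- u) w = - dot u w.
Proof. by rewrite /dot mulNmx mxE. Qed.

Lemma dotZl (R : realType) (n : nat) (a : R) (u w : 'rV[R]_n) :
  dot (a *: u) w = a * dot u w.
Proof. by rewrite /dot -scalemxAl mxE. Qed.

Lemma dot0l (R : realType) (n : nat) (w : 'rV[R]_n) : dot 0 w = 0.
Proof. by rewrite /dot mul0mx mxE. Qed.

Lemma dotDr (R : realType) (n : nat) (u v w : 'rV[R]_n) :
  dot w (u + v) = dot w u + dot w v.
Proof. by rewrite dotC dotDl !(dotC w). Qed.

Lemma dotNr (R : realType) (n : nat) (u w : 'rV[R]_n) : dot w (- u) = - dot w u.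
Proof. by rewrite dotC dotNl dotC. Qed.

Lemma dotZr (R : realType) (n : nat) (a : R) (u w : 'rV[R]_n) :
  dot w (a *: u) = a * dot w u.
Proof. by rewrite dotC dotZl dotC. Qed.

Lemma dot_mulmx (R : realType) (n : nat) (A : 'M[R]_n) (u v : 'rV[R]_n) :
  dot (u *m A) v = dot u (v *m A^T).
Proof. by rewrite /dot trmx_mul trmxK mulmxA. Qed.

Lemma dot_ge0 (R : realType) (n : nat) (u : 'rV[R]_n) : 0 <= dot u u.
Proof. by rewrite dotE sumr_ge0// => j _; rewrite -expr2 sqr_ge0. Qed.

Lemma enorm_ge0 (R : realType) (n : nat) (u : 'rV[R]_n) : 0 <= enorm u.
Proof. exact: sqrtr_ge0. Qed.

Lemma sqr_enorm (R : realType) (n : nat) (u : 'rV[R]_n) :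
  enorm u ^+ 2 = dot u u.
Proof.
rewrite /enorm sqr_sqrtr.
  by rewrite dotE; apply: eq_bigr => j _; rewrite expr2.
by apply: sumr_ge0 => j _; rewrite sqr_ge0.
Qed.

Lemma enormN (R : realType) (n : nat) (u : 'rV[R]_n) : enorm (- u) = enorm u.
Proof.
by apply/eqP; rewrite -(@eqrXn2 _ 2) ?enorm_ge0// !sqr_enorm dotNl dotNr opprK.
Qed.

Lemma enorm_le (R : realType) (n : nat) (c : R) (u v : 'rV[R]_n) :
  0 <= c -> (enorm u <= c * enorm v) = (dot u u <= c ^+ 2 * dot v v).
Proof.
move=> c0; rewrite -!sqr_enorm -exprMn ler_sqr ?nnegrE ?enorm_ge0//.
by rewrite mulr_ge0// enorm_ge0.
Qed.

(** * Calculus of quadratic functions *)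

Definition quad (R : realType) (n : nat) (M : 'M[R]_n) (g z x : 'rV[R]_n) : R :=
  2^-1 * dot ((x - z) *m M) (x - z) - dot (x - z) g.

(** The exact second-order expansion, from which the differential, the convexity and the optimality
    condition are derived. *)
Lemma quad_shift (R : realType) (n : nat) (M : 'M[R]_n) (g z x h : 'rV[R]_n) :
  M^T = M ->
  quad M g z (x + h) =
    quad M g z x + dot ((x - z) *m M - g) h + 2^-1 * dot (h *m M) h.
Proof.
move=> sM; rewrite /quad [x + h - z]addrAC; move: (x - z) => y.
rewrite mulmxDl !(dotDl, dotDr, dotNl, dotNr) (dot_mulmx M h y) sM.
rewrite (dotC h (y *m M)) (dotC h g); lra.
Qed.

Lemma is_diff_sum (R : realType) (V : normedModType R) n
    (f df : 'I_n -> V -> R^o) (x : V) :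
  (forall i, is_diff x (f i) (df i)) ->
  is_diff x (\sum_(i < n) f i) (\sum_(i < n) df i).
Proof.
move=> H; elim/big_ind2 : _ => [|u1 u2 v1 v2 h1 h2|//].
  exact: is_diff_cst.
exact: is_diffD.
Qed.

Lemma is_diff_coord (R : realType) n (x : 'rV[R]_n) (j : 'I_n) :
  is_diff x (fun y : 'rV[R]_n => y 0 j : R^o) (fun y => y 0 j).
Proof.
(* The coordinate map is packaged by hand as a linear map; being continuous, it is its own
   differential. *)
have @f : {linear 'rV[R]_n -> R^o}.
  by exists (fun N : 'rV[R]_n => N 0 j); do 2![eexists]; do ?[constructor];
     rewrite ?mxE// => ? *; rewrite ?mxE//; move=> ?; rewrite !mxE.
have fc : continuous f by exact: coord_continuous.
apply: DiffDef; first exact: (linear_differentiable (f := f)).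
exact: (diff_lin (f := f)).
Qed.

Lemma is_diff_dot (R : realType) n (u x : 'rV[R]_n) :
  is_diff x (fun y => dot u y : R^o) (fun y => dot u y).
Proof.
have -> : (fun y => dot u y : R^o) =
    \sum_(j < n) (u 0 j *: ((fun y : 'rV[R]_n => y 0 j) : _ -> R^o)).
  by apply/funext => y; rewrite dotE fct_sumE; apply: eq_bigr.
apply: is_diff_sum => j; apply: is_diffZ; exact: is_diff_coord.
Qed.


(** By symmetry, entry [j] of [y *m M] is the inner product of row [j] of [M] with [y]. The
    quadratic form is thus a sum of products of linear forms, and the product rule applies. *)
Lemma is_diff_quad (R : realType) n (M : 'M[R]_n) (g z x : 'rV[R]_n) :
  M^T = M ->
  is_diff x (quad M g z : _ -> R^o) (fun h => dot ((x - z) *m M - g) h).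
Proof.
move=> sM.
pose q0 (y : 'rV[R]_n) : R^o := dot (y *m M) y.
have dq0 : is_diff x q0 (fun h => 2 * dot (x *m M) h).
  have -> : q0 = \sum_(j < n)
     ((fun y => dot (row j M) y : R^o) * (fun y : 'rV[R]_n => y 0 j : R^o)).
    apply/funext => y; rewrite /q0 dotE fct_sumE; apply: eq_bigr => j _ /=.
    congr (_ * _); rewrite dotE mxE; apply: eq_bigr => i _.
    by rewrite mxE mulrC -[in LHS]sM mxE.
  apply: is_diff_eq.
    apply: is_diff_sum => j; apply: is_diffM; first exact: is_diff_dot.
    exact: is_diff_coord.
  apply/funext => h; rewrite fct_sumE.
  have -> : 2 * dot (x *m M) h = dot (x *m M) h + dot (h *m M) x.
    by rewrite (dot_mulmx M h x) sM (dotC h); lra.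
  rewrite 2!dotE -big_split; apply: eq_bigr => j _ /=.
  have Mrow (w : 'rV[R]_n) : (w *m M) 0 j = dot (row j M) w.
    rewrite dotE mxE; apply: eq_bigr => i _.
    by rewrite mxE mulrC -[in LHS]sM mxE.
  rewrite !Mrow [X in _ = _ + X]mulrC; exact: erefl.
(* Expanding around 0 splits [quad] into the form [q0], a linear form [l] and the constant [a]. *)
pose a := quad M g z 0.
pose l : 'rV[R]_n := - (z *m M) - g.
have -> : quad M g z = 2^-1 *: q0 + (fun y => dot l y : R^o) + cst a.
  apply/funext => y.
  transitivity (2^-1 * dot (y *m M) y + dot l y + a); last by [].
  rewrite -[y in LHS]add0r quad_shift// sub0r mulNmx -/a -/l; ring.
have dqla := is_diffD (is_diffD (is_diffZ (2^-1) dq0) (is_diff_dot l x))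
  (is_diff_cst (a : R^o) x).
apply: is_diff_eq dqla _.
apply/funext => h; rewrite !fctE addr0.
transitivity (2^-1 * (2 * dot (x *m M) h) + dot l h); first by [].
by rewrite mulKf ?pnatr_eq0// mulmxBl !(dotDl, dotNl) !addrA.
Qed.

Lemma differentiable_quad (R : realType) n (M : 'M[R]_n) (g z x : 'rV[R]_n) :
  M^T = M -> differentiable (quad M g z : 'rV[R]_n -> R^o) x.
Proof. by move=> /(is_diff_quad g z x) []. Qed.

Lemma grad_quad (R : realType) n (M : 'M[R]_n) (g z x : 'rV[R]_n) :
  M^T = M -> grad (quad M g z) x = (x - z) *m M - g.
Proof.
move=> sM; apply/rowP => j; rewrite mxE.
have dq := is_diff_quad g z x sM; rewrite diff_val.
rewrite dotE (bigD1 j)//= big1 ?addr0 => [|i ij].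
  by rewrite [X in _ * X]mxE !eqxx mulr1.
by rewrite [X in _ * X]mxE (negPf ij) andbF mulr0.
Qed.

(** The convexity gap is an exact multiple of the quadratic form at [x - y], so convexity follows
    from positive semidefiniteness. *)
Lemma quad_convex_comb (R : realType) n (M : 'M[R]_n) (g z x y : 'rV[R]_n)
    (t : R) :
  M^T = M ->
  quad M g z (t *: x + (1 - t) *: y) =
    t * quad M g z x + (1 - t) * quad M g z y
    - 2^-1 * t * (1 - t) * dot ((x - y) *m M) (x - y).
Proof.
move=> sM.
have -> : t *: x + (1 - t) *: y = y + t *: (x - y).
  by rewrite scalerBl scale1r scalerBr addrCA.
rewrite -[in t * quad M g z x](subrKC y x) !quad_shift//.
rewrite -scalemxAl !(dotZl, dotZr); ring.
Qed.

(** * Problems with a single nonzero component, a convex quadratic *)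

Section QuadProblem.
Variables (R : realType) (m n : nat) (i0 : 'I_m) (M : 'M[R]_n) (g z : 'rV[R]_n).
Variables (mu ell : R).
Hypothesis M_sym : M^T = M.
Hypothesis M_psd : forall v : 'rV[R]_n, 0 <= dot (v *m M) v.
Hypothesis M_bound : forall v : 'rV[R]_n, enorm (v *m M) <= ell * enorm v.
Hypothesis mu_gt0 : 0 < mu.
Hypothesis ell_gt0 : 0 < ell.

Definition qcomp (i : 'I_m) (x : 'rV[R]_n) : R :=
  if i == i0 then quad M g z x else 0.

Definition qdgf (x : 'rV[R]_n) : R := 2^-1 * enorm (x - z) ^+ 2.

Lemma qcomp_eq i : i = i0 -> qcomp i = quad M g z.
Proof. by move=> ->; apply/funext => x; rewrite /qcomp eqxx. Qed.

Lemma qcomp_neq i : i != i0 -> qcomp i = cst 0.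
Proof. by move=> /negPf ii0; apply/funext => x; rewrite /qcomp ii0. Qed.

Lemma grad_qcomp i x :
  grad (qcomp i) x = if i == i0 then (x - z) *m M - g else 0.
Proof.
have [/qcomp_eq ->|/qcomp_neq ->] := eqVneq i i0; first exact: grad_quad.
apply/rowP => j; rewrite !mxE.
by rewrite (_ : 'd _ _ = 0 :> (_ -> _))// diff_cst.
Qed.

Lemma qfeasible_convex : convex_set [set: 'rV[R]_n].
Proof. by move=> x y l _ _; rewrite inE. Qed.

Lemma qcomp_convex i : convex_function setT (qcomp i).
Proof.
move=> t x y _ _; have [/qcomp_eq ->|/qcomp_neq ->] := eqVneq i i0.
  rewrite convRE -[conv t x y]/(t%:num *: (x : 'rV[R]_n) + (1 - t%:num) *: y).
  rewrite quad_convex_comb// -[unstable.onem _]/(1 - t%:num) gerDl oppr_le0.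
  have t1 : 0 <= 1 - t%:num by rewrite subr_ge0 le1.
  by rewrite !mulr_ge0 ?invr_ge0.
by rewrite convRE /= !mulr0 addr0.
Qed.

Lemma qcomp_differentiable i (x : 'rV[R]_n) :
  differentiable (qcomp i : 'rV[R]_n -> R^o) x.
Proof.
have [/qcomp_eq ->|/qcomp_neq ->] := eqVneq i i0.
  exact: differentiable_quad.
exact: differentiable_cst.
Qed.

Lemma qcomp_lipschitz i (x y : 'rV[R]_n) :
  enorm (grad (qcomp i) x - grad (qcomp i) y) <= ell * enorm (x - y).
Proof.
rewrite !grad_qcomp; case: eqP => _.
  rewrite opprB addrA subrK -mulmxBl opprB addrA subrK.
  exact: M_bound.
rewrite subrr [leLHS](_ : _ = 0) ?mulr_ge0 ?enorm_ge0 ?ltW//.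
by apply/eqP; rewrite -sqrf_eq0 sqr_enorm dot0l.
Qed.

Lemma qsimple_convex : convex_function [set: 'rV[R]_n] (fun=> 0 : R).
Proof. by move=> t x y _ _; rewrite convRE /= !mulr0 addr0. Qed.

Lemma qdgf_strongly_convex : strongly_convex1 setT qdgf.
Proof.
move=> x y t _ _ t01; rewrite /qdgf !sqr_enorm.
have -> : t *: x + (1 - t) *: y - z = (y - z) + t *: (x - y).
  by rewrite scalerBl scale1r scalerBr addrCA addrAC.
have -> : x - z = (y - z) + (x - y) by rewrite [RHS]addrC addrA subrK.
rewrite !(dotDl (y - z), dotDr (y - z)).
rewrite !(dotZl, dotZr) (dotC (x - y) (y - z)).
rewrite le_eqVlt; apply/orP; left; apply/eqP; ring.
Qed.

(** Even the zero components get the Lipschitz constant [ell], so that the total is [m] times [ell].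
    The quadratic and the function [qdgf] share the centre [z]. *)
Definition quad_problem : problem R m n :=
  Problem closedT qfeasible_convex qcomp_convex qcomp_differentiable
    (fun=> ell_gt0) qcomp_lipschitz qsimple_convex qdgf_strongly_convex mu_gt0.

(** The hypothesis cancels the first-order term, so a displacement [h] raises the objective by half
    of [dot (h *m M) h + mu * dot h h]. *)
Lemma optimal_quad_problem (ys : 'rV[R]_n) :
  ys *m M + mu *: ys = g -> optimal quad_problem (z + ys).
Proof.
move=> yg; split=> // x _; rewrite /objective /=.
have sumE y : \sum_(i < m) qcomp i y = quad M g z y.
  rewrite (bigD1 i0)//= qcomp_eq// big1 ?addr0// => i /qcomp_neq ->//.
rewrite !sumE !addr0 -(subrKC (z + ys) x) (quad_shift g z (z + ys))//.
move: (x - _) => h; rewrite /qdgf !sqr_enorm.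
have -> : z + ys + h - z = ys + h by rewrite -(addrA z) (addrC z) addrK.
have -> : z + ys - z = ys by rewrite addrAC subrr add0r.
have -> : ys *m M - g = - (mu *: ys) by rewrite -yg opprD addrA subrr sub0r.
rewrite dotNl dotZl !(dotDl, dotDr) (dotC h ys).
rewrite -subr_ge0.
rewrite [X in 0 <= X](_ : _ =
  2^-1 * dot (h *m M) h + mu * (2^-1 * dot h h)); last by field.
by rewrite addr_ge0 ?mulr_ge0 ?invr_ge0 ?dot_ge0// ltW.
Qed.

End QuadProblem.

(** * Shifts and supports of row vectors *)

Definition shift_mx (R : realType) (n : nat) : 'M[R]_n :=
  \matrix_(i, j) (i.+1 == j)%:R.

Definition supported (R : realType) (n r : nat) (v : 'rV[R]_n) :=
  forall j : 'I_n, (r <= j)%N -> v 0 j = 0.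

Lemma supported_shift (R : realType) n r (v : 'rV[R]_n) :
  supported r v -> supported r.+1 (v *m shift_mx R n).
Proof.
move=> vr j rj; rewrite mxE big1// => i _; rewrite mxE; case: eqP => [ij|_].
  by rewrite vr ?mul0r// -ltnS ij.
by rewrite mulr0.
Qed.

Lemma supported_shiftT (R : realType) n r (v : 'rV[R]_n) :
  supported r v -> supported r (v *m (shift_mx R n)^T).
Proof.
move=> vr j rj; rewrite mxE big1// => i _; rewrite !mxE; case: eqP => [ij|_].
  by rewrite vr ?mul0r// -ij leqW.
by rewrite mulr0.
Qed.

Lemma supportedZ (R : realType) n r (a : R) (v : 'rV[R]_n) :
  supported r v -> supported r (a *: v).
Proof. by move=> vr j rj; rewrite mxE vr ?mulr0. Qed.

Lemma supportedD (R : realType) n r (u v : 'rV[R]_n) :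
  supported r u -> supported r v -> supported r (u + v).
Proof. by move=> ur vr j rj; rewrite mxE ur ?vr ?addr0. Qed.

Lemma supportedN (R : realType) n r (v : 'rV[R]_n) :
  supported r v -> supported r (- v).
Proof. by move=> vr j rj; rewrite mxE vr ?oppr0. Qed.

Lemma supportedW (R : realType) n r s (v : 'rV[R]_n) :
  (r <= s)%N -> supported r v -> supported s v.
Proof. by move=> rs vr j sj; apply: vr; apply: leq_trans sj. Qed.

Lemma mul_shift_shiftT (R : realType) n (v : 'rV[R]_n) j :
  (v *m shift_mx R n *m (shift_mx R n)^T) 0 j = (j.+1 < n)%:R * v 0 j.
Proof.
rewrite -mulmxA mxE (bigD1 j)//= big1 ?addr0 => [|i ij].
  rewrite mulrC; congr (_ * _); rewrite mxE; case: ltnP => jn.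
    rewrite (bigD1 (Ordinal jn))//= big1 ?addr0 => [|i ij];
      rewrite !mxE ?eqxx ?mulr1//.
    suff /negPf -> : j.+1 != i by rewrite mulr0.
    by apply: contra ij => /eqP ji; apply/eqP/val_inj.
  rewrite big1// => i _; rewrite !mxE.
  case: eqP => [ji|_]; last by rewrite mulr0.
  by move: (ltn_ord i); rewrite -ji ltnNge jn.
rewrite mxE big1 ?mulr0// => k _; rewrite !mxE.
case: eqP => [<-|]; last by rewrite mul0r.
case: eqP => [[ji]|]; last by rewrite mulr0.
by move: ij; rewrite (val_inj ji) eqxx.
Qed.

Lemma mul_shiftT_shift (R : realType) n (v : 'rV[R]_n) j :
  (v *m (shift_mx R n)^T *m shift_mx R n) 0 j = (0 < j)%:R * v 0 j.
Proof.
rewrite -mulmxA mxE (bigD1 j)//= big1 ?addr0 => [|i ij].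
  rewrite mulrC; congr (_ * _); rewrite mxE; case: ltnP => j0.
    have jn : (j.-1 < n)%N by rewrite prednK// ltnW.
    rewrite (bigD1 (Ordinal jn))//= big1 ?addr0 => [|i ij];
      rewrite !mxE /= ?prednK ?eqxx ?mulr1//.
    suff /negPf -> : i.+1 != j by rewrite mulr0.
    by apply: contra ij => /eqP ji; apply/eqP/val_inj => /=; rewrite -ji.
  rewrite big1// => i _; rewrite !mxE.
  case: eqP => [ji|_]; last by rewrite mulr0.
  by move: j0; rewrite -ji.
rewrite mxE big1 ?mulr0// => k _; rewrite !mxE.
case: eqP => [ki|]; last by rewrite mul0r.
case: eqP => [kj|]; last by rewrite mulr0.
by move: ij; rewrite -(inj_eq val_inj) /= -ki kj eqxx.
Qed.

Lemma dot_bool_le (R : realType) n (b : 'I_n -> bool) (u v : 'rV[R]_n) :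
  (forall j, u 0 j = (b j)%:R * v 0 j) -> dot u v <= dot v v.
Proof.
move=> uv; rewrite !dotE; apply: ler_sum => j _; rewrite uv.
by case: (b j); rewrite ?mul1r// !mul0r -expr2 sqr_ge0.
Qed.

(** Moving one shift across the inner product leaves the shift times its transpose, the coordinate
    projection that kills the last entry. *)
Lemma dot_shift_le (R : realType) n (v : 'rV[R]_n) :
  dot (v *m shift_mx R n) (v *m shift_mx R n) <= dot v v.
Proof.
rewrite dot_mulmx dotC; exact: dot_bool_le (mul_shift_shiftT v).
Qed.

Lemma dot_shiftT_le (R : realType) n (v : 'rV[R]_n) :
  dot (v *m (shift_mx R n)^T) (v *m (shift_mx R n)^T) <= dot v v.
Proof.
rewrite dot_mulmx trmxK dotC; exact: dot_bool_le (mul_shiftT_shift v).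
Qed.

(* The weights 2 - q, 1, 1, q of the four terms sum up to 4. *)
Lemma sqr_weighted_le (R : realType) (q a b c e : R) : 0 <= q -> q <= 1 ->
  ((2 - q) * a - b - c + q * e) ^+ 2 <=
    4 * ((2 - q) * a ^+ 2 + b ^+ 2 + c ^+ 2 + q * e ^+ 2).
Proof.
move=> q0 q1; have q2 : 0 <= 2 - q by lra.
rewrite -subr_ge0 [leRHS](_ : _ = (2 - q) * ((a + b) ^+ 2 + (a + c) ^+ 2
  + q * (a - e) ^+ 2) + (b - c) ^+ 2 + q * ((b + e) ^+ 2 + (c + e) ^+ 2)).
  by move: (2 - q) q2 => w w0; rewrite !(sqr_ge0, addr_ge0, mulr_ge0).
ring.
Qed.

(** * The tridiagonal matrix of the hard component *)

Section Chain.
Variables (R : realType) (n : nat) (q mu : R).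
Hypotheses (q_gt0 : 0 < q) (q_lt1 : q < 1) (mu_gt0 : 0 < mu).

Let S := shift_mx R n.
Definition chain_scale : R := mu / (1 - q) ^+ 2.
Definition chain_factor : 'M[R]_n := 1%:M - q *: S.
(** Adding [mu] times the identity leaves a product of two bidiagonal factors, which makes the
    optimality system explicitly solvable. Entrywise, for [q < 1], this is [chain_scale * q] times
    the matrix with 2 on the diagonal, except for a last entry [2 - q], and -1 beside it. *)
Definition chain_mx : 'M[R]_n :=
  chain_scale *: (chain_factor *m chain_factor^T) - mu%:M.

Let beta := chain_scale.
Let G := chain_factor.

Lemma chain_scale_gt0 : 0 < chain_scale.
Proof. by rewrite divr_gt0 ?exprn_gt0// subr_gt0. Qed.

Let mu_beta : mu = beta * (1 - q) ^+ 2.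
Proof. by rewrite divfK// gt_eqF// exprn_gt0// subr_gt0. Qed.

Lemma chain_mx_sym : chain_mx^T = chain_mx.
Proof. by rewrite /chain_mx linearB linearZ /= trmx_mul trmxK tr_scalar_mx. Qed.

Lemma mul_factor (v : 'rV[R]_n) : v *m G = v - q *: (v *m S).
Proof. by rewrite mulmxBr mulmx1 -scalemxAr. Qed.

Lemma mul_factorT (v : 'rV[R]_n) : v *m G^T = v - q *: (v *m S^T).
Proof. by rewrite linearB linearZ /= trmx1 mulmxBr mulmx1 -scalemxAr. Qed.

Lemma mul_chain (v : 'rV[R]_n) :
  v *m chain_mx = beta *: (v *m G *m G^T) - mu *: v.
Proof. by rewrite mulmxBr -scalemxAr mulmxA mul_mx_scalar. Qed.

(** Since [mu] equals [beta * (1 - q) ^+ 2], it is enough that [G] shrinks no vector by more than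
    the factor [1 - q]. *)
Lemma chain_mx_psd (v : 'rV[R]_n) : 0 <= dot (v *m chain_mx) v.
Proof.
rewrite mul_chain dotDl dotNl !dotZl (dot_mulmx G^T) trmxK.
rewrite {1}mu_beta -mulrA -mulrBr mulr_ge0 ?(ltW chain_scale_gt0)// subr_ge0.
have le_shift := dot_shift_le v.
have : (1 - q) * dot v v - q * (1 - q) * dot (v *m S) (v *m S) <=
    dot (v *m G) (v *m G).
  rewrite mul_factor !dotE !mulr_sumr -sumrB; apply: ler_sum => j _.
  rewrite !mxE; set a := v 0 j; set b := \sum_(i < n) _.
  (* The identity is [(a - q b)^2 = (1 - q) a^2 - q (1 - q) b^2 + q (a - b)^2]. *)
  rewrite -subr_ge0 [X in 0 <= X](_ : _ = q * (a - b) ^+ 2); last by ring.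
  by rewrite mulr_ge0 ?sqr_ge0// ltW.
apply: le_trans; rewrite -/S in le_shift.
have : 0 <= q * (1 - q) * (dot v v - dot (v *m S) (v *m S)).
  by rewrite !mulr_ge0 ?subr_ge0// ltW.
lra.
Qed.

(** Up to the factor [beta * q], the matrix combines four contractions with coefficients of absolute
    sum 4. The estimate is made entry by entry with a weighted Cauchy-Schwarz inequality. *)
Lemma chain_mx_bound (ell : R) (v : 'rV[R]_n) :
  4 * beta * q <= ell -> enorm (v *m chain_mx) <= ell * enorm v.
Proof.
move=> b_ell.
have b0 : 0 <= beta := ltW chain_scale_gt0.
have bq0 : 0 <= 4 * beta * q.
  exact: mulr_ge0 (mulr_ge0 (ler0n _ 4) b0) (ltW q_gt0).
apply: (@le_trans _ _ (4 * beta * q * enorm v)); last first.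
  by rewrite ler_wpM2r ?enorm_ge0.
rewrite enorm_le//.
set b1 := v *m S; set b2 := v *m S^T; set b3 := v *m S *m S^T.
have l1 : dot b1 b1 <= dot v v by exact: dot_shift_le.
have l2 : dot b2 b2 <= dot v v by exact: dot_shiftT_le.
have l3 : dot b3 b3 <= dot v v by apply: le_trans l1; exact: dot_shiftT_le.
have -> : v *m chain_mx = (beta * q) *: ((2 - q) *: v - b1 - b2 + q *: b3).
  rewrite mul_chain mul_factorT mul_factor mulmxBl -scalemxAl -/b1 -/b2 -/b3.
  by apply/rowP => j; rewrite !mxE {1}mu_beta; ring.
rewrite dotZl dotZr mulrA -expr2.
rewrite [X in _ <= X](_ : _ = (beta * q) ^+ 2 * (16 * dot v v)); last by ring.
rewrite ler_wpM2l ?sqr_ge0//.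
apply: (@le_trans _ _
  (4 * ((2 - q) * dot v v + dot b1 b1 + dot b2 b2 + q * dot b3 b3))).
  move: b1 b2 b3 {l1 l2 l3} => b1 b2 b3.
  rewrite !dotE !mulr_sumr -!big_split mulr_sumr; apply: ler_sum => j _ /=.
  rewrite !mxE; move: (v 0 j) (b1 0 j) (b2 0 j) (b3 0 j) => a b c e.
  by have := sqr_weighted_le a b c e (ltW q_gt0) (ltW q_lt1); rewrite !expr2.
have : q * dot b3 b3 <= q * dot v v by rewrite ler_wpM2l// ltW.
lra.
Qed.

(** The factor [G] moves entries to the right by at most one place, and its transpose only to the
    left. *)
Lemma supported_chain r (v : 'rV[R]_n) :
  supported r v -> supported r.+1 (v *m chain_mx).
Proof.
move=> vr; rewrite mul_chain.
apply: supportedD; last exact/supportedN/supportedZ/(supportedW (leqnSn r)).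
apply: supportedZ.
have vG : supported r.+1 (v *m G).
  rewrite mul_factor; apply: supportedD; first exact: (supportedW (leqnSn r)).
  exact/supportedN/supportedZ/supported_shift.
rewrite mul_factorT; apply: supportedD => //.
exact/supportedN/supportedZ/supported_shiftT.
Qed.

End Chain.

(** * The geometric solution and its distance to vectors of short support *)

Section GeometricSolution.
Variables (R : realType) (n : nat) (q mu B : R).
Hypotheses (q_gt0 : 0 < q) (q_lt1 : q < 1).

Definition geom_row : 'rV[R]_n.+1 := \row_j (B * q ^+ j).

(** The factor [chain_factor] annihilates a geometric sequence outside its first entry, and its
    transpose fixes the first basis vector. The far end causes no error term, so the solution is
    exact in every dimension. *)
Lemma geom_row_solution :
  geom_row *m chain_mx n.+1 q mu + mu *: geom_row =
    (chain_scale q mu * B) *: delta_mx 0 0.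
Proof.
rewrite mul_chain subrK.
have -> : geom_row *m chain_factor n.+1 q = B *: delta_mx 0 0.
  rewrite mul_factor; apply/rowP => j; rewrite !mxE eqxx /=.
  case: j => -[|j] jn /=.
    rewrite big1 => [|i _]; first by rewrite expr0 mulr0 subr0.
    by rewrite !mxE mulr0.
  rewrite (bigD1 (Ordinal (ltnW jn)))//= big1 => [|i ij].
    by rewrite !mxE eqxx exprS /= mulr1; ring.
  rewrite !mxE/=; case: eqP => [[e]|]; last by rewrite mulr0.
  by move: ij; rewrite -(inj_eq val_inj) /= e eqxx.
rewrite mul_factorT -scalemxAl.
have -> : delta_mx 0 0 *m (shift_mx R n.+1)^T = 0 :> 'rV[R]_n.+1.
  apply/rowP => j; rewrite mxE big1 ?mxE// => i _; rewrite !mxE.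
  case: (eqVneq i 0) => [->|_]; last by rewrite andbF mul0r.
  by rewrite mulr0.
by rewrite !scaler0 subr0 scalerA.
Qed.

Lemma dot_geom_row :
  dot geom_row geom_row = B ^+ 2 * \sum_(j < n.+1) (q ^+ 2) ^+ j.
Proof.
rewrite dotE mulr_sumr; apply: eq_bigr => j _; rewrite mxE.
by rewrite -exprM mulnC exprM; ring.
Qed.

(** The whole tail from [r] on is missed. With [u = q ^+ 2], the tail is the fraction
    [(u^r - u^(n+1)) / (1 - u^(n+1))] of the full geometric sum, and the denominator is at most
    1. *)
Lemma supported_dist_geom_row r (y : 'rV[R]_n.+1) : supported r y ->
  dot geom_row geom_row * ((q ^+ 2) ^+ r - (q ^+ 2) ^+ n.+1) <=
    dot (y - geom_row) (y - geom_row).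
Proof.
move=> yr; rewrite dot_geom_row; set u := q ^+ 2.
have u0 : 0 < u by rewrite exprn_gt0.
have u1 : u < 1 by rewrite exprn_ilt1// ltW.
(* When [r] reaches the dimension, the left-hand side is at most 0. *)
have [nr|rn] := leqP n.+1 r.
  apply: le_trans (dot_ge0 _).
  apply: mulr_ge0_le0; last by rewrite subr_le0 ler_wiXn2l// ltW.
  by rewrite -dot_geom_row dot_ge0.
rewrite (dotE (y - _)).
apply: (@le_trans _ _ (B ^+ 2 * \sum_(j < n.+1 | (r <= j)%N) u ^+ j));
  last first.
  rewrite mulr_sumr [leRHS](bigID (fun j : 'I_n.+1 => (r <= j)%N)) /=.
  rewrite ler_wpDr ?sumr_ge0// => [i _|]; first by rewrite -expr2 sqr_ge0.
  apply: ler_sum => j rj; rewrite !mxE yr// sub0r mulrNN.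
  by rewrite -exprM mulnC exprM le_eqVlt; apply/orP; left; apply/eqP; ring.
rewrite -mulrA ler_wpM2l ?sqr_ge0//.
rewrite -(ler_pM2l (x := 1 - u)) ?subr_gt0//.
have geo k : (1 - u) * \sum_(j < k) u ^+ j = 1 - u ^+ k.
  by rewrite -opprB mulNr -subrX1 opprB.
have -> : (1 - u) * \sum_(j < n.+1 | (r <= j)%N) u ^+ j = u ^+ r - u ^+ n.+1.
  have := geo n.+1; rewrite (bigID (fun j : 'I_n.+1 => (j < r)%N)) /=.
  rewrite -(big_ord_widen _ (fun j => u ^+ j) (ltnW rn)) mulrDr geo => e.
  under eq_bigl do rewrite leqNgt.
  by apply: (addrI (1 - u ^+ r)); rewrite e addrA subrK.
rewrite mulrA geo ler_piMl//.
  by rewrite subr_ge0 ler_wiXn2l ?(ltW u0, ltW u1, ltnW rn).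
by rewrite gerBl exprn_ge0// ltW.
Qed.

End GeometricSolution.

(** * Counting the draws of the hard component *)

Definition draws (T : Type) (m : nat) (idx : nat -> T -> 'I_m) (i0 : 'I_m)
    (k : nat) (w : T) : nat :=
  \sum_(t < k) (idx t w == i0).

Lemma supported_span (R : realType) (n r : nat) (us : seq 'rV[R]_n)
    (v : 'rV[R]_n) :
  (forall u, u \in us -> supported r u) -> v \in <<us>>%VS -> supported r v.
Proof.
move=> ur vu j rj; rewrite (coord_span (X := in_tuple us) vu) summxE.
rewrite big1// => i _.
by rewrite mxE (ur _ (mem_nth 0 (ltn_ord i)) _ rj) mulr0.
Qed.

Lemma draws_le (T : Type) m (idx : nat -> T -> 'I_m) i0 t k w :
  (t <= k)%N -> (draws idx i0 t w <= draws idx i0 k w)%N.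
Proof.
move=> tk; rewrite /draws -!(big_mkord xpredT (fun t => (idx t w == i0) : nat)).
by rewrite [leqRHS](big_cat_nat (n := t))//= leq_addr.
Qed.

Lemma drawsS (T : Type) m (idx : nat -> T -> 'I_m) i0 t w :
  draws idx i0 t.+1 w = (draws idx i0 t w + (idx t w == i0))%N.
Proof. by rewrite /draws big_ord_recr. Qed.

Section Sampling.
Context d (T : measurableType d) (R : realType) (Pr : probability T R).
Variables (m : nat) (p : 'I_m -> R) (idx : nat -> T -> 'I_m) (i0 : 'I_m).
Hypothesis iid : iid_sampling Pr p idx.

Lemma prob_no_draw k :
  measurable [set w | draws idx i0 k w = 0%N] /\
  Pr [set w | draws idx i0 k w = 0%N] = ((1 - p i0) ^+ k)%:E.
Proof.
have [_ _ midx Pidx indep] := iid.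
have -> : [set w | draws idx i0 k w = 0%N] =
    \bigcap_(t in [set` iota 0 k]) idx t @^-1` (~` [set i0]).
  apply/seteqP; split=> w /=.
    move/eqP; rewrite sum_nat_eq0 => /forallP /= H t /=.
    rewrite mem_iota /= add0n => tk ti; have := H (Ordinal tk).
    by rewrite /= ti eqxx.
  move=> H; apply/eqP; rewrite sum_nat_eq0; apply/forallP => t /=.
  by rewrite eqb0; apply/negP => /eqP; apply: H; rewrite /= mem_iota /= add0n.
split.
  apply: bigcap_measurableType => t _; rewrite -preimage_setC.
  exact: measurableC.
rewrite (indep _ (fun=> ~` [set i0])) ?iota_uniq//.
under eq_bigr => t _ do rewrite -preimage_setC probability_setC// Pidx -EFinB.
rewrite prodEFin; congr EFin.
by rewrite big_const_seq count_predT size_iota iter_mulr_1.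
Qed.

Lemma draws_indic k w : (draws idx i0 k w)%:R =
  \sum_(t <- iota 0 k) (\1_(idx t @^-1` [set i0]) w : R).
Proof.
rewrite /draws natr_sum -(big_mkord xpredT (fun t => (idx t w == i0)%:R)).
rewrite /index_iota subn0; apply: eq_bigr => t _; rewrite indicE.
by congr ((_ : bool)%:R); apply/eqP/idP; rewrite inE.
Qed.

Lemma expectation_draws k :
  (\int[Pr]_w ((draws idx i0 k w)%:R)%:E = (k%:R * p i0)%:E)%E.
Proof.
have [_ _ midx Pidx _] := iid.
under eq_integral do rewrite draws_indic -sumEFin.
rewrite ge0_integral_sum//; last first.
  by move=> t; apply/measurable_EFinP; exact: measurable_indic.
rewrite (eq_bigr (fun=> (p i0)%:E)) => [|t _]; last first.
  by rewrite integral_indic// setIT; exact: Pidx.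
rewrite sumEFin; congr EFin.
by rewrite big_const_seq count_predT size_iota iter_addr_0 mulr_natl.
Qed.

Lemma measurable_draws k :
  measurable_fun setT (fun w => (draws idx i0 k w)%:R : R).
Proof.
have [_ _ midx _ _] := iid.
under eq_fun do rewrite draws_indic.
by apply: measurable_sum => t; exact: measurable_indic.
Qed.

End Sampling.

(** * Lower bounds for expectations *)

Lemma expectation_ge_on d (T : measurableType d) (R : realType)
    (Pr : probability T R) (X : T -> R) (A : set T) (b : R) :
  measurable A -> measurable_fun setT X -> 0 <= b -> (forall w, 0 <= X w) ->
  (forall w, A w -> b <= X w) -> (b%:E * Pr A <= 'E_Pr[X])%E.
Proof.
move=> mA mX b0 X0 bX.
have -> : Pr A = (\int[Pr]_w (\1_A w : R)%:E)%E.
  by rewrite integral_indic// setIT.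
have mA1 : measurable_fun setT (EFin \o (\1_A : T -> R)).
  by apply/measurable_EFinP; exact: measurable_indic.
rewrite unlock -ge0_integralZl_EFin//; apply: ge0_le_integral => //=.
- by move=> w _; rewrite lee_fin mulr_ge0.
- exact: measurable_funeM.
- exact/measurable_EFinP.
- move=> w _; rewrite lee_fin indicE; have [wA|_] := boolP (w \in A).
    by rewrite mulr1 bX// -in_setE.
  by rewrite mulr0.
Qed.

(* Stated as [b <= E[X] + a E[Y]] to keep all the integrands nonnegative. *)
Lemma expectation_ge_affine d (T : measurableType d) (R : realType)
    (Pr : probability T R) (X Y : T -> R) (a b EY : R) :
  measurable_fun setT X -> measurable_fun setT Y -> 0 <= a -> 0 <= b ->
  (forall w, 0 <= X w) -> (forall w, 0 <= Y w) ->
  (\int[Pr]_w (Y w)%:E = EY%:E)%E ->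
  (forall w, b <= X w + a * Y w) -> (b%:E <= 'E_Pr[X] + (a * EY)%:E)%E.
Proof.
move=> mX mY a0 b0 X0 Y0 EYE bXY.
have mEX : measurable_fun setT (EFin \o X) by exact/measurable_EFinP.
have mEY : measurable_fun setT (EFin \o Y) by exact/measurable_EFinP.
have maEY : measurable_fun setT (fun w => a%:E * (Y w)%:E)%E.
  exact: measurable_funeM.
rewrite unlock EFinM -EYE -ge0_integralZl_EFin//=; last first.
  by move=> w _; rewrite lee_fin.
rewrite -ge0_integralD//=; last 2 first.
- by move=> w _; rewrite lee_fin.
- by move=> w _; rewrite lee_fin mulr_ge0.
rewrite -[leLHS]mule1 -(@probability_setT _ _ _ Pr) -integral_cst//.
apply: ge0_le_integral => //=; first exact: emeasurable_funD.
by move=> w _; rewrite lee_fin.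
Qed.

Lemma measurable_sqr_enorm d (T : measurableType d) (R : realType) n
    (x : T -> 'rV[R]_n) (xs : 'rV[R]_n) :
  (forall j, measurable_fun setT (fun w => x w 0 j)) ->
  measurable_fun setT (fun w => enorm (x w - xs) ^+ 2).
Proof.
move=> mx.
rewrite (_ : (fun w => _) =
    fun w => \sum_(j <- enum 'I_n) (x w 0 j - xs 0 j) ^+ 2).
  apply: measurable_sum => j; apply: measurable_funX.
  exact: measurable_funB.
apply/funext => w; rewrite sqr_enorm dotE big_enum /=.
by apply: eq_bigr => j _; rewrite !mxE expr2.
Qed.

(** * Progress of a method on a quadratic problem *)

Section QuadMethod.
Context d (T : measurableType d) (R : realType) (Pr : probability T R).
Variables (m n : nat) (p : 'I_m -> R) (idx : nat -> T -> 'I_m).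
Variables (iter : problem R m n -> 'rV[R]_n -> nat -> T -> 'rV[R]_n).
Variables (i0 : 'I_m) (M : 'M[R]_n) (g z : 'rV[R]_n) (mu ell : R).
Hypothesis M_sym : M^T = M.
Hypothesis M_psd : forall v : 'rV[R]_n, 0 <= dot (v *m M) v.
Hypothesis M_bound : forall v : 'rV[R]_n, enorm (v *m M) <= ell * enorm v.
Hypothesis mu_gt0 : 0 < mu.
Hypothesis ell_gt0 : 0 < ell.
Hypothesis method : incremental_gradient_method Pr p idx iter.
Hypothesis M_supp : forall r v, supported r v -> supported r.+1 (v *m M).
Hypothesis g_supp : supported 1 g.

Let P := quad_problem i0 g z M_sym M_psd M_bound mu_gt0 ell_gt0.

(** Strong induction on [k]: a gradient in the span is zero unless [i0] was drawn at its time [t],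
    and then it uncovers one coordinate more than the draws before [t] did, which the draw at [t]
    pays for. *)
Lemma supported_iter k w : supported (draws idx i0 k w) (iter P z k w - z).
Proof.
elim/ltn_ind: k => k IH.
have [_ /(_ P z I k) [_ /(_ w)]] := method.
apply: supported_span => u /mapP[t]; rewrite mem_iota /= add0n => tk -> {u}.
rewrite grad_qcomp//; case: eqP => [it|_]; last by move=> j _; rewrite mxE.
apply: (@supportedW _ _ (draws idx i0 t w).+1).
  by rewrite -addn1 (leq_trans _ (draws_le idx i0 w tk))// drawsS it eqxx.
apply: supportedD; first exact/M_supp/IH.
exact/supportedN/(supportedW _ g_supp).
Qed.

End QuadMethod.

(** * Estimates turning a small error into many iterations *)

Lemma small_prob (R : realType) (m : nat) (p : 'I_m -> R) :
  (0 < m)%N -> \sum_(i < m) p i = 1 -> exists i, p i <= m%:R^-1.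
Proof.
move=> m0 p1; apply: contrapT => H.
have : \sum_(i < m) m%:R^-1 < \sum_(i < m) p i.
  apply: ltr_sum => [|i _]; first by apply/hasP; exists (Ordinal m0).
  by rewrite ltNge; apply/negP => pi; apply: H; exists i.
rewrite p1 sumr_const card_ord -[X in X < _]mulr_natl.
by rewrite divff ?ltxx// pnatr_eq0 -lt0n.
Qed.

Lemma expr_small (R : realType) (u e : R) : 0 < u -> u < 1 -> 0 < e ->
  exists N, u ^+ N <= e.
Proof.
move=> u0 u1 e0.
have u1' : `|u| < 1 by rewrite gtr0_norm.
have /cvgr0Pnorm_le /(_ _ e0) [N _ HN] := cvg_expr u1'.
by exists N; rewrite (le_trans (ler_norm _))//; exact: HN (leqnn N).
Qed.

(** To be used with [W] the sum of [sqrt (m C)] and [m], and [a] the larger of the two. *)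
Lemma scaled_bound (R : realType) (W a l k : R) :
  0 <= W -> W <= 2 * a -> 0 < a -> 0 <= k -> l <= 24 * k / a ->
  48^-1 * (W * l) <= k.
Proof.
move=> W0 Wa a0 k0 lk.
suff : W * l <= 48 * k by lra.
have [l0|l0] := leP l 0.
  by apply: (@le_trans _ _ 0); [rewrite mulr_ge0_le0|rewrite mulr_ge0].
rewrite (le_trans (ler_wpM2r (ltW l0) Wa))//.
apply: (@le_trans _ _ (2 * a * (24 * k / a))).
  by rewrite ler_wpM2l// mulr_ge0// ltW.
by rewrite le_eqVlt; apply/orP; left; apply/eqP; field; rewrite gt_eqF.
Qed.

Lemma ln_le_of_geometric (R : realType) (m k : nat) (D2 eps p : R) :
  (1 < m)%N -> 0 < D2 -> 0 < eps -> p <= m%:R^-1 ->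
  D2 * (1 - p) ^+ k <= eps -> ln (D2 / eps) <= 2 * k%:R / m%:R.
Proof.
move=> m1 D0 e0 pm H.
have m0 : 0 < m%:R :> R by rewrite ltr0n ltnW.
have x0 : 0 < m%:R^-1 :> R by rewrite invr_gt0.
have x2 : m%:R^-1 <= 2^-1 :> R by rewrite lef_pV2 ?posrE// ler_nat.
rewrite -[leRHS]expRK ler_ln ?posrE ?expR_gt0 ?divr_gt0// ler_pdivrMr//.
have -> : 2 * k%:R / m%:R = k%:R * (2 * m%:R^-1) :> R by ring.
rewrite expRM_natl mulrC.
apply: le_trans (ler_wpM2r _ H); last by rewrite exprn_ge0// expR_ge0.
rewrite -mulrA -exprMn; apply: ler_peMr; first exact: ltW.
apply: exprn_ege1.
(* For [0 <= x <= 1/2] one has [(1 - x) (1 + 2 x) = 1 + x (1 - 2 x) >= 1]; the bound [x <= 1/2]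
   comes from [1 < m]. *)
apply: (@le_trans _ _ ((1 - m%:R^-1) * (1 + 2 * m%:R^-1))).
  by move: m%:R^-1 x0 x2 => x x0 x2; nra.
apply: ler_pM; [lra|lra|lra|exact: expR_ge1Dx].
Qed.

(** This is Jensen's inequality for the convex function [r |-> u ^+ r], evaluated at the mean number
    of draws. *)
Lemma expectation_geometric_draws d (T : measurableType d) (R : realType)
    (Pr : probability T R) (m : nat) (p : 'I_m -> R) (idx : nat -> T -> 'I_m)
    (i0 : 'I_m) (k : nat) (X : T -> R) (D2 u v eps : R) :
  iid_sampling Pr p idx -> measurable_fun setT X -> (forall w, 0 <= X w) ->
  0 <= D2 -> 0 < u -> u < 1 -> 0 <= v ->
  (forall w, D2 * (u ^+ draws idx i0 k w - v) <= X w) ->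
  ('E_Pr[X] <= eps%:E)%E -> 0 <= eps ->
  D2 * (expR (k%:R * p i0 * ln u) - v) <= eps.
Proof.
move=> iid mX X0 D0 u0 u1 v0 HX EX eps0.
have lnu : ln u < 0 by rewrite ln_lt0// u0.
set a := k%:R * p i0; set s := expR _.
have a0 : 0 <= a by rewrite mulr_ge0//; have [] := iid.
(* If [s <= v] the claim is trivial; otherwise [b] below is nonnegative, as [expectation_ge_affine]
   requires. *)
have [sv|vs] := leP s v.
  by apply: le_trans eps0; rewrite mulr_ge0_le0// subr_le0.
pose c := D2 * (s * - ln u).
have c0 : 0 <= c by rewrite !mulr_ge0 ?expR_ge0// oppr_ge0 ltW.
pose b := D2 * (s - v) + c * a.
have b0 : 0 <= b.
  by apply: addr_ge0; apply: mulr_ge0; rewrite ?subr_ge0 ?(ltW vs).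
have := expectation_ge_affine (Pr := Pr) mX (measurable_draws i0 iid k) c0 b0 X0
  (fun w => ler0n _ _) (expectation_draws i0 iid k).
(* The tangent line of [r |-> u ^+ r] at the expected number [a] of draws. *)
have tangent w : b <= X w + c * (draws idx i0 k w)%:R.
  rewrite -lerBlDr; apply: le_trans (HX w); set r := draws _ _ _ _.
  rewrite [leLHS](_ : _ = D2 * (s * (1 + (r%:R - a) * ln u) - v)); last first.
    by rewrite /b /c; ring.
  rewrite ler_wpM2l// lerB//.
  have -> : u ^+ r = s * expR ((r%:R - a) * ln u).
    by rewrite -expRD -mulrDl addrC subrK expRM_natl lnK.
  by rewrite ler_wpM2l ?expR_ge0// expR_ge1Dx.
move=> /(_ tangent) /le_trans /(_ (leeD2r _ EX)).
by rewrite -/a -EFinD lee_fin /b lerD2r.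
Qed.

(** The truncation term [v] is absorbed at the price of a square root: [sg ^+ 2 + v <= sg]. The
    constant 24 collects a factor 2 from this root, 2 from the square of [q], and 6 from
    [- ln q <= 6 / s]. *)
Lemma ln_le_of_chain (R : realType) (m k : nat) (D eps s v p : R) :
  (0 < m)%N -> 0 < D -> 0 < eps -> eps < D ^+ 2 -> 0 < s -> p <= m%:R^-1 ->
  v <= Num.sqrt eps / D - (Num.sqrt eps / D) ^+ 2 ->
  D ^+ 2 * (expR (k%:R * p * ln ((s / (s + 6)) ^+ 2)) - v) <= eps ->
  ln (D ^+ 2 / eps) <= 24 * k%:R / (m%:R * s).
Proof.
move=> m0 D0 e0 eD s0 pm; set sg := Num.sqrt eps / D; set q := s / (s + 6).
move=> vs H.
have m0' : 0 < m%:R :> R by rewrite ltr0n.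
have s6 : 0 < s + 6 by rewrite addr_gt0.
have q0 : 0 < q by rewrite divr_gt0.
have sg0 : 0 < sg by rewrite divr_gt0// sqrtr_gt0.
have sg2 : sg ^+ 2 = eps / D ^+ 2 by rewrite expr_div_n sqr_sqrtr// ltW.
have D2 : 0 < D ^+ 2 by rewrite exprn_gt0.
have lnq : - ln q <= 6 / s.
  rewrite -lnV ?posrE// invf_div.
  have -> : (s + 6) / s = 1 + 6 / s by rewrite mulrDl divff ?gt_eqF.
  by rewrite le_ln1Dx// (lt_trans (ltrN10 _))// divr_gt0.
have lnq0 : ln q <= 0.
  by rewrite ln_le0// ler_pdivrMr// mul1r lerDl.
have lq2 : ln (q ^+ 2) = 2 * ln q by rewrite lnXn// mulr_natl.
have : expR (k%:R * p * ln (q ^+ 2)) <= sg.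
  move: H; rewrite mulrC -ler_pdivlMr// -sg2; lra.
rewrite -ler_ln ?posrE ?expR_gt0// expRK lq2 => Hln.
have lsg : ln (D ^+ 2 / eps) = - 2 * ln sg.
  have -> : D ^+ 2 / eps = (sg ^+ 2)^-1 by rewrite sg2 invf_div.
  by rewrite lnV ?posrE ?exprn_gt0// lnXn// mulNr mulr_natl.
rewrite lsg.
have kp : k%:R * p * (- ln q) <= k%:R * m%:R^-1 * (6 / s).
  apply: (@le_trans _ _ (k%:R * m%:R^-1 * - ln q)).
    by rewrite ler_wpM2r ?oppr_ge0// ler_wpM2l.
  by rewrite ler_wpM2l// mulr_ge0// invr_ge0 ltW.
have -> : 24 * k%:R / (m%:R * s) = 4 * (k%:R * m%:R^-1 * (6 / s)).
  by field; rewrite !gt_eqF.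
lra.
Qed.

Lemma supported0_eq0 (R : realType) n (v : 'rV[R]_n) : supported 0 v -> v = 0.
Proof. by move=> v0; apply/rowP => j; rewrite mxE v0. Qed.

(** * Choice of the hard problem according to the sizes of [L / mu] and [m] *)

Unset Implicit Arguments.

(* The worst-case problem is moreover plain, except possibly when m = 1 and
   L < mu: for a plain problem with m = 1, the iteration
   x |-> x0 - grad f x / mu contracts with factor L / mu, so that no constant c
   works uniformly as L / mu tends to 0. *)
Theorem corollary3 (R : realType) :
  exists2 c : R, 0 < c &
  forall (m : nat) (L mu D eps : R),
    (0 < m)%N -> 0 < L -> 0 < mu -> 0 < D -> 0 < eps ->
  exists N : nat, forall n : nat, (N <= n)%N ->
  forall (d : measure_display) (T : measurableType d) (Pr : probability T R)
    (p : 'I_m -> R) (idx : nat -> T -> 'I_m)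
    (iter : problem R m n -> 'rV[R]_n -> nat -> T -> 'rV[R]_n),
    incremental_gradient_method Pr p idx iter ->
  forall x0 : 'rV[R]_n,
  exists (P : problem R m n) (xs : 'rV[R]_n),
    [/\ total_lip P = L,
        modulus P = mu,
        feasible P x0 /\ enorm (x0 - xs) = D,
        optimal P xs &
        (1 < m)%N \/ mu <= L -> plain_problem P x0] /\
    forall k : nat, finds_solution Pr P xs eps (iter P x0 k) ->
      c * ((Num.sqrt (m%:R * cond_number P) + m%:R)
           * ln (enorm (x0 - xs) ^+ 2 / eps)) <= k%:R.
Proof.
(* The constant is 2 times 24: [W] is at most twice its larger summand, and 24 comes from the chain
   estimate. *)
exists 48^-1; first by rewrite invr_gt0.
move=> m L mu D eps m0 L0 mu0 D0 eps0.
have m0' : 0 < m%:R :> R by rewrite ltr0n.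
pose C := L / mu; have C0 : 0 < C by rewrite divr_gt0.
pose ell := L / m%:R; have ell0 : 0 < ell by rewrite divr_gt0.
pose s := Num.sqrt (C / m%:R); have s0 : 0 < s by rewrite sqrtr_gt0 divr_gt0.
(* With this [q] the norm bound of the chain matrix becomes [mu * s * (s + 6) / 9], at most
   [ell = mu * s ^+ 2] once [s >= 1]. *)
pose q := s / (s + 6).
have s6 : 0 < s + 6 by rewrite addr_gt0.
have q0 : 0 < q by rewrite divr_gt0.
have q1 : q < 1 by rewrite ltr_pdivrMr// mul1r ltrDl.
have sumL : \sum_(i < m) ell = L.
  by rewrite sumr_const card_ord -mulr_natr divfK// gt_eqF.
pose sg := Num.sqrt eps / D.
(* The dimension must push the truncation term below the gap [sg - sg ^+ 2], which is positive when
   [eps < D ^+ 2]. Otherwise the logarithm is at most 0 and the bound is trivial. *)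
have [N0 HN0] : exists N, eps < D ^+ 2 -> (q ^+ 2) ^+ N <= sg - sg ^+ 2.
  have [eD|De] := ltP eps (D ^+ 2); last by exists 0%N.
  have sg1 : sg < 1.
    rewrite ltr_pdivrMr// mul1r -(ltr_sqr (x := Num.sqrt eps)).
    - by rewrite sqr_sqrtr ?ltW.
    - by rewrite nnegrE sqrtr_ge0.
    - by rewrite nnegrE ltW.
  have sg0 : 0 < sg by rewrite divr_gt0// sqrtr_gt0.
  have [|||N HN] := @expr_small R (q ^+ 2) (sg - sg ^+ 2).
  - by rewrite exprn_gt0.
  - by rewrite exprn_ilt1// ltW.
  - by rewrite subr_gt0 expr2 gtr_pMr.
  by exists N.
(* The successor keeps the dimension positive, so that a first coordinate exists. *)
exists N0.+1 => -[//|n] nN d T Pr p idx iter method x0.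
have [iid meas] := method.
have [p0 p1 _ _ _] := iid.
have [i0 pi0] := small_prob m0 p1.
have M0_psd (v : 'rV[R]_n.+1) : 0 <= dot (v *m 0) v by rewrite mulmx0 dot0l.
have M0_bound (v : 'rV[R]_n.+1) :
    enorm (v *m (0 : 'M[R]_n.+1)) <= ell * enorm v.
  by rewrite (enorm_le _ _ (ltW ell0)) mulmx0 dot0l mulr_ge0 ?sqr_ge0 ?dot_ge0.
have M0_sym : (0 : 'M[R]_n.+1)^T = 0 by rewrite trmx0.
have e0_supp a : supported 1 (a *: delta_mx 0 0 : 'rV[R]_n.+1).
  by move=> [[|j] jn] // _; rewrite !mxE mulr0.
have enorm_e0 (a : R) : 0 <= a -> enorm (a *: delta_mx 0 0 : 'rV[R]_n.+1) = a.
  move=> a0; apply/eqP; rewrite -(@eqrXn2 _ 2) ?enorm_ge0// sqr_enorm.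
  rewrite dotZl dotZr dotE (bigD1 0)//= big1 ?addr0 => [|j /negPf j0];
    rewrite !mxE ?eqxx /=.
    by rewrite !mulr1 expr2.
  by rewrite j0 mul0r.
pose W := Num.sqrt (m%:R * C) + m%:R.
have W0 : 0 <= W by rewrite addr_ge0 ?sqrtr_ge0 ?ler0n.
pose QP M g z S1 S2 S3 :=
  @quad_problem R m n.+1 i0 M g z mu ell S1 S2 S3 mu0 ell0.
(* All regimes use a [quad_problem] with solution [z + ys]; what remains in each is its data and a
   bound on [k]. *)
have reduce M g z ys S1 S2 S3 :
    ys *m M + mu *: ys = g -> enorm (x0 - (z + ys)) = D ->
    ((1 < m)%N \/ mu <= L -> z = x0) ->
    (forall k, ('E_Pr[fun w => (enorm
         (iter (QP M g z S1 S2 S3) x0 k w - (z + ys)) ^+ 2)%R] <= eps%:E)%E ->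
       48^-1 * (W * ln (D ^+ 2 / eps)) <= k%:R) ->
  exists (P : problem R m n.+1) (xs : 'rV[R]_n.+1),
    [/\ total_lip P = L,
        modulus P = mu,
        feasible P x0 /\ enorm (x0 - xs) = D,
        optimal P xs &
        (1 < m)%N \/ mu <= L -> plain_problem P x0] /\
    forall k : nat, finds_solution Pr P xs eps (iter P x0 k) ->
      48^-1 * ((Num.sqrt (m%:R * cond_number P) + m%:R)
           * ln (enorm (x0 - xs) ^+ 2 / eps)) <= k%:R.
  pose P := QP M g z S1 S2 S3.
  move=> opt dist pl bound; exists P, (z + ys); split.
    split=> //; first exact: optimal_quad_problem.
    by move=> /pl zx0; split=> //; rewrite /P/= zx0.
  move=> k [_ /bound]; rewrite dist /cond_number.
  by rewrite (_ : total_lip P = L).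
have trivial_bound k : D ^+ 2 <= eps -> 48^-1 * (W * ln (D ^+ 2 / eps)) <= k%:R.
  move=> De; apply: (@le_trans _ _ 0) => //; rewrite mulr_ge0_le0 ?invr_ge0//.
  by rewrite mulr_ge0_le0// ln_le0// ler_pdivrMr// mul1r.
have [Cm|mC] := ltP C m%:R.
  have [m1|m1] : (1 < m)%N \/ (m <= 1)%N by case: ltnP; [left|right].
    (* A linear component of slope [mu * D] puts the solution at distance [D] from [x0], in a
       direction seen only once [i0] is drawn. *)
    apply: (reduce 0 ((mu * D) *: delta_mx 0 0) x0 (D *: delta_mx 0 0)
      M0_sym M0_psd M0_bound) => //.
    - by rewrite mulmx0 add0r scalerA.
    - by rewrite opprD addrA subrr sub0r enormN enorm_e0// ltW.
    move=> k; set P := QP _ _ _ _ _ _ => HE.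
    have [mA PA] := prob_no_draw i0 iid k.
    have mX : measurable_fun setT
        (fun w => enorm (iter P x0 k w - (x0 + D *: delta_mx 0 0)) ^+ 2).
      by apply: measurable_sqr_enorm; have [] := meas P x0 I k.
    have := expectation_ge_on Pr mA mX (sqr_ge0 D) (fun w => sqr_ge0 _).
    rewrite PA => HA.
    have {}HA : D ^+ 2 * (1 - p i0) ^+ k <= eps.
      rewrite -lee_fin EFinM; apply: le_trans HE; apply: HA => w /= w0.
      have : supported 0 (iter P x0 k w - x0).
        have : supported (draws idx i0 k w) (iter P x0 k w - x0).
          apply: (supported_iter _ _ _ _ _ _ method) => // r v _ j _.
          by rewrite mulmx0 mxE.
        by rewrite w0.
      move=> /supported0_eq0 /eqP; rewrite subr_eq0 => /eqP ->.
      by rewrite opprD addrA subrr sub0r enormN enorm_e0// ltW.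
    have := ln_le_of_geometric m1 (exprn_gt0 2 D0) eps0 pi0 HA => lnk.
    have Wm : W <= 2 * m%:R.
      rewrite mulr_natl mulr2n lerD2r -[leRHS]ger0_norm// -sqrtr_sqr.
      by rewrite ler_sqrt ?exprn_gt0// expr2 ler_wpM2l// ltW.
    apply: (scaled_bound W0 Wm m0') => //; apply: le_trans lnk _.
    by rewrite ler_pM2r ?invr_gt0// ler_wpM2r// ler_nat.
  have m1' : m = 1%N by apply/eqP; rewrite eqn_leq m1 m0.
  have Lmu : L < mu by move: Cm; rewrite m1' ltr_pdivrMr// mul1r.
  (* All gradients vanish and the centre of [dgf] is the solution, so the method stays at [x0] and
     success forces [D ^+ 2 <= eps]. *)
  apply: (reduce 0 0 (x0 + D *: delta_mx 0 0) 0 M0_sym M0_psd M0_bound) => //.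
  - by rewrite mulmx0 add0r scaler0.
  - by rewrite addr0 opprD addrA subrr sub0r enormN enorm_e0// ltW.
  - by rewrite m1' => -[//|]; rewrite leNgt Lmu.
  move=> k; set P := QP _ _ _ _ _ _ => HE.
  apply: trivial_bound; move: HE.
  rewrite (_ : (fun w => _) = cst (D ^+ 2)) ?expectation_cst ?lee_fin//.
  apply/funext => w /=.
  have [_ /(_ w) Hspan] := meas P x0 I k.
  have : supported 0 (iter P x0 k w - x0).
    apply: supported_span Hspan => u /mapP[t _ ->].
    rewrite grad_qcomp//; case: eqP => _ j _; last by rewrite mxE.
    by rewrite mulmx0 subrr mxE.
  move=> /supported0_eq0 /eqP; rewrite subr_eq0 => /eqP ->.
  by rewrite addr0 opprD addrA subrr sub0r enormN enorm_e0// ltW.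
(* From here on [C >= m], and [sqrt (m C) = m s] is the larger summand of [W]. *)
have s1 : 1 <= s.
  by rewrite -sqrtr1 ler_wsqrtr// ler_pdivlMr// mul1r.
have s2 : s ^+ 2 = C / m%:R by rewrite sqr_sqrtr// divr_ge0// ltW.
pose Z := \sum_(j < n.+1) (q ^+ 2) ^+ j.
have Z0 : 0 < Z.
  rewrite /Z big_ord_recl expr0 ltr_pwDl// sumr_ge0// => j _.
  by rewrite !exprn_ge0// ltW.
(* This amplitude gives the geometric solution the norm [D]. *)
pose B := D / Num.sqrt Z.
pose M := chain_mx n.+1 q mu.
have M_bound v : enorm (v *m M) <= ell * enorm v.
  apply: chain_mx_bound => //.
  have -> : 4 * chain_scale q mu * q = mu * (s * (s + 6) / 9).
    rewrite /chain_scale; have -> : 1 - q = 6 / (s + 6).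
      by rewrite /q; field; rewrite gt_eqF.
    by rewrite /q; field; rewrite gt_eqF.
  have -> : ell = mu * s ^+ 2.
    by rewrite s2 /C /ell; field; rewrite !gt_eqF.
  rewrite ler_wpM2l ?(ltW mu0)// ler_pdivrMr// expr2 -mulrA.
  rewrite ler_wpM2l ?(ltW s0)//.
  lra.
have dys : dot (geom_row n q B) (geom_row n q B) = D ^+ 2.
  by rewrite dot_geom_row -/Z expr_div_n sqr_sqrtr ?divfK// ?gt_eqF// ltW.
apply: (reduce M ((chain_scale q mu * B) *: delta_mx 0 0) x0 (geom_row n q B)
  (chain_mx_sym n.+1 q mu) (chain_mx_psd q0 q1 mu0) M_bound) => //.
- exact: geom_row_solution.
- rewrite opprD addrA subrr sub0r enormN.
  by apply/eqP; rewrite -(@eqrXn2 _ 2) ?enorm_ge0 ?ltW// sqr_enorm dys.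
move=> k; set P := QP _ _ _ _ _ _ => HE.
have [eD|] := ltP eps (D ^+ 2); last exact: trivial_bound.
have mX : measurable_fun setT
    (fun w => enorm (iter P x0 k w - (x0 + geom_row n q B)) ^+ 2).
  by apply: measurable_sqr_enorm; have [] := meas P x0 I k.
have HX w : D ^+ 2 * ((q ^+ 2) ^+ draws idx i0 k w - (q ^+ 2) ^+ n.+1) <=
    enorm (iter P x0 k w - (x0 + geom_row n q B)) ^+ 2.
  rewrite sqr_enorm opprD addrA -dys; apply: supported_dist_geom_row => //.
  apply: (supported_iter _ _ _ _ _ _ method) => // r v.
  exact: supported_chain.
have u0 : 0 < q ^+ 2 by rewrite exprn_gt0.
have u1 : q ^+ 2 < 1 by rewrite exprn_ilt1// ltW.
have := expectation_geometric_draws iid mX (fun w => sqr_ge0 _)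
  (ltW (exprn_gt0 2 D0)) u0 u1 (exprn_ge0 n.+1 (ltW u0)) HX HE (ltW eps0).
have v_le : (q ^+ 2) ^+ n.+1 <= sg - sg ^+ 2.
  by apply: le_trans (HN0 eD); rewrite ler_wiXn2l ?ltW// ltnW.
move=> /(ln_le_of_chain m0 D0 eps0 eD s0 pi0 v_le).
apply: scaled_bound => //; last by rewrite mulr_gt0.
have -> : W = m%:R * s + m%:R.
  rewrite /W (_ : m%:R * C = (m%:R * s) ^+ 2); last first.
    by rewrite exprMn s2; field; rewrite gt_eqF.
  by rewrite sqrtr_sqr ger0_norm// mulr_ge0// ltW.
by rewrite [leRHS]mulr_natl mulr2n lerD2l ler_peMr.
Qed.
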